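(* Every grid graph admits a reducible regular outside-obstacle representation (OOR). That is, for all positive integers $k$ and $\ell$, the graph $P_k \square P_\ell$ admits a reducible regular OOR.
   Context: All graphs are finite and simple. $P_k = \langle v_1,\dots,v_k\rangle$ denotes a simple path with $k$ vertices. A grid graph is a graph of the form $P_k \square P_\ell$ for positive integers $k,\ell$: its vertex set is $V(P_k)\times V(P_\ell)$, and it has an edge between $(v_i,v_j)$ and $(v_{i'},v_{j'})$ if and only if ($|i-i'|=0$ and $|j-j'|=1$) or ($|i-i'|=1$ and $|j-j'|=0$). A straight-line drawing $\Gamma$ of a graph $G$ maps the vertices to pairwise distinct points of $\mathbb{R}^2$ and each edge to the closed line segment between its endpoints. The outer face of $\Gamma$ is the unbounded connected component of the complement in $\mathbb{R}^2$ of the union of all vertex points and edge segments. The planarization of $\Gamma$ is obtained by replacing all intersection points of edges by dummy vertices (so edges are subdivided at crossings). A non-edge of $G$ is a pair of distinct non-adjacent vertices; it is identified with the line segment between its endpoints. An outside-obstacle representation (OOR) of $G$ is a straight-line drawing of $G$ such that no edge segment contains a vertex point other than its two endpoints and every non-edge segment intersects the outer face of the drawing. (Equivalently, $G$ is the visibility graph of the point set with respect to a single obstacle, namely the open outer face of the drawing.) An OOR of a graph with $n$ vertices is regular if the vertex points form a regular $n$-gon, i.e., they are $n$ equally spaced points on a circle. An OOR is reducible if every edge is incident to the outer face, i.e., for every edge at least one of the sub-segments into which it is divided in the planarization lies on the boundary of the outer face. *)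

(* Defs.v *)
(* MathComp-Analysis; the plane is R * R with its product topology. *)
From HB Require Import structures.
From mathcomp Require Import all_boot all_order all_algebra.
From mathcomp Require Import all_classical all_reals all_analysis.

Set Implicit Arguments.
Unset Strict Implicit.
Unset Printing Implicit Defensive.

Import Order.TTheory GRing.Theory Num.Theory.
Import numFieldNormedType.Exports.

Local Open Scope classical_set_scope.
Local Open Scope ring_scope.

(* The vertices v_1, ..., v_k of P_k are indexed from 0 by 'I_k. *)
Definition grid_adj (k l : nat) : rel ('I_k * 'I_l) :=
  fun a b =>
    ((`|a.1 - b.1|%N == 0%N) && (`|a.2 - b.2|%N == 1%N)) ||
    ((`|a.1 - b.1|%N == 1%N) && (`|a.2 - b.2|%N == 0%N)).

Lemma grid_adj_sym (k l : nat) : symmetric (@grid_adj k l).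
Proof. by move=> a b; rewrite /grid_adj !(distnC b.1) !(distnC b.2). Qed.

Lemma grid_adj_irrefl (k l : nat) : irreflexive (@grid_adj k l).
Proof. by move=> a; rewrite /grid_adj !distnn. Qed.

Section Drawings.
Variable R : realType.
Local Notation plane := (R * R)%type.

Definition segment (p q : plane) : set plane :=
  [set (1 - t) *: p + t *: q | t in `[0, 1]].

Definition boundary (A : set plane) : set plane := closure A `\` interior A.

(* The simple graph is given by its adjacency relation [adj] (symmetric and
   irreflexive) on the finite vertex type [V]; [pos] is the placement of the
   vertices. *)
Variables (V : finType) (adj : rel V) (pos : V -> plane).

Definition drawing_union : set plane :=
  range pos `|`
  [set x | exists u v, adj u v /\ segment (pos u) (pos v) x].

(* As [drawing_union] is compact, its complement has exactly one unbounded
   component: the set below, of all points whose component is unbounded. *)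
Definition outer_face : set plane :=
  [set x | (~` drawing_union) x /\
           ~ bounded_set (connected_component (~` drawing_union) x)].

Definition oor : Prop :=
  [/\ injective pos,
      forall u v w, adj u v -> segment (pos u) (pos v) (pos w) ->
        w = u \/ w = v
    & forall u v, u != v -> ~~ adj u v ->
        segment (pos u) (pos v) `&` outer_face !=set0].

Definition ngon_point (c : plane) (r theta : R) (n i : nat) : plane :=
  c + r *: (cos (theta + 2 * pi * i%:R / n%:R),
            sin (theta + 2 * pi * i%:R / n%:R)).

Definition regular_placement : Prop :=
  exists (c : plane) (r theta : R), 0 < r /\
    range pos = [set ngon_point c r theta #|V| i | i in [set i | (i < #|V|)%N]].

(* Distinctness of edges is that of unordered pairs: (u, v) and (v, u) are the
   same edge and do not cross each other. *)
Definition planarization_vertices : set plane :=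
  range pos `|`
  [set x | exists u v u' v',
     [/\ adj u v, adj u' v', [set u; v]%SET != [set u'; v']%SET,
         segment (pos u) (pos v) x & segment (pos u') (pos v') x]].

(* [segment p q] is one of the pieces into which the edge uv is divided: its
   two distinct ends are its only vertices of the planarization. *)
Definition planarization_piece (u v : V) (p q : plane) : Prop :=
  [/\ p != q, segment p q `<=` segment (pos u) (pos v)
    & segment p q `&` planarization_vertices = [set p; q]].

Definition reducible_drawing : Prop :=
  forall u v, adj u v ->
    exists p q, planarization_piece u v p q /\
                segment p q `<=` boundary outer_face.

Definition reducible_regular_oor : Prop :=
  [/\ oor, regular_placement & reducible_drawing].

End Drawings.

(* Main.v *)
Require Import Defs.
From mathcomp Require Import all_boot all_order all_algebra.
From mathcomp Require Import all_classical all_reals all_analysis.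
From mathcomp Require Import ring lra zify.

(* Colour the grid like a chessboard and walk once around the n-gon: first the
   even vertices (i, j), ordered lexicographically by (i, j), then the odd ones,
   ordered lexicographically by (j, i). Then for any two vertices u <> v, one
   of them, say u, has all its neighbours other than v strictly on one side of
   the line uv. Hence the open angular sector at u on the other side of uv is
   empty of edges: from a point of uv close to u, the ray on that side parallel
   to the tangent of the circle at u escapes to infinity, because every edge
   avoiding u lies in a half-plane {x | <x, u> <= m} with m < 1. So every
   non-edge meets the outer face. If uv is an edge, sliding this ray's origin
   along uv up to the first crossing shows that the piece of uv at u is on the
   boundary of the outer face. *)

Set Implicit Arguments.
Unset Strict Implicit.
Unset Printing Implicit Defensive.

Import Order.TTheory GRing.Theory Num.Theory.
Import numFieldNormedType.Exports.

Local Open Scope classical_set_scope.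
Local Open Scope ring_scope.

(** * Segments and rays in the plane *)

Section Plane.
Variable R : realType.
Local Notation plane := (R * R)%type.

Definition dot (p q : plane) : R := p.1 * q.1 + p.2 * q.2.

Definition orient (p q r : plane) : R :=
  (q.1 - p.1) * (r.2 - p.2) - (q.2 - p.2) * (r.1 - p.1).

Definition tangent (p : plane) (e : R) : plane := (- (e * p.2), e * p.1).

Lemma lineE (p d : plane) (t : R) : p + t *: d = (p.1 + t * d.1, p.2 + t * d.2).
Proof. by []. Qed.

Lemma continuous_line (p d : plane) : continuous (fun t : R => p + t *: d).
Proof.
move=> t; apply: cvgD; first exact: cvg_cst.
by apply: cvgZr_tmp; exact: cvg_id.
Qed.

Lemma segmentP (p q x : plane) :
  segment p q x <-> exists2 t : R, 0 <= t <= 1 & x = p + t *: (q - p).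
Proof.
split=> [[t]|[t t01 ->]].
  rewrite /= in_itv /= => t01 <-; exists t => //.
  by rewrite scalerBl scale1r scalerBr addrA addrAC.
exists t; first by rewrite /= in_itv.
by rewrite scalerBl scale1r scalerBr addrA addrAC.
Qed.

Lemma segment_sym (p q : plane) : segment p q = segment q p.
Proof.
suff sub (a b : plane) : segment a b `<=` segment b a.
  by apply/seteqP; split; exact: sub.
move=> x /segmentP[t /andP[t0 t1] ->]; apply/segmentP; exists (1 - t).
  by rewrite subr_ge0 t1 gerBl t0.
by rewrite !lineE; congr pair => /=; ring.
Qed.

Lemma segmentxx (p : plane) : segment p p = [set p].
Proof.
apply/seteqP; split=> [x /segmentP[t _ ->]|_ ->] /=.
  by rewrite subrr scaler0 addr0.
by apply/segmentP; exists 0; rewrite ?lexx ?ler01// scale0r addr0.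
Qed.

Lemma segment_image (p q : plane) :
  segment p q = (fun t : R => p + t *: (q - p)) @` `[0, 1].
Proof.
apply/seteqP; split=> [x /segmentP[t t01 ->]|_ [t t01 <-]].
  by exists t => //=; rewrite in_itv.
by apply/segmentP; exists t => //; move: t01; rewrite /= in_itv.
Qed.

Lemma segment_connected (p q : plane) : connected (segment p q).
Proof.
rewrite segment_image; apply: connected_continuous_connected.
  exact/connected_intervalP/interval_is_interval.
exact/continuous_subspaceT/continuous_line.
Qed.

Lemma segment_closed (p q : plane) : closed (segment p q).
Proof.
apply: compact_closed; first exact: norm_hausdorff.
rewrite segment_image; apply: continuous_compact; last exact: segment_compact.
exact/continuous_subspaceT/continuous_line.
Qed.

Lemma ray_connected (p d : plane) :
  connected ((fun t : R => p + t *: d) @` `[0, +oo[).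
Proof.
apply: connected_continuous_connected.
  exact/connected_intervalP/interval_is_interval.
exact/continuous_subspaceT/continuous_line.
Qed.

Lemma ray_unbounded (p d : plane) : d != 0 ->
  ~ bounded_set ((fun t : R => p + t *: d) @` `[0, +oo[).
Proof.
move=> d0 [M [_ /(_ (`|M| + 1))]].
have -> : M < `|M| + 1 by rewrite ltr_pwDr// ler_norm.
move=> /(_ isT) B; have nd : 0 < `|d| by rewrite normr_gt0.
(* With this t the vector [t *: d] has norm |M| + 2 + |p|, so [p + t *: d] has norm at least |M| +
   2, beyond the assumed bound |M| + 1. *)
pose t := (`|M| + 2 + `|p|) / `|d|.
have t0 : 0 <= t by rewrite divr_ge0 ?normr_ge0// !addr_ge0.
have /B : ((fun t : R => p + t *: d) @` `[0, +oo[) (p + t *: d).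
  by exists t => //=; rewrite in_itv /= t0.
have := lerB_normD (t *: d) p; rewrite normrZ (ger0_norm t0) divfK ?gt_eqF//.
rewrite [t *: d + p]addrC => nlb /= nub; lra.
Qed.

End Plane.

(** * Sufficient conditions for lying in the outer face *)

Section OuterFace.
Variables (R : realType) (V : finType) (adj : rel V) (pos : V -> R * R).
Local Notation plane := (R * R)%type.
Local Notation D := (drawing_union adj pos).
Local Notation F := (outer_face adj pos).

(** The ray is connected, so it lies in the component of p and makes that component unbounded. *)
Lemma outer_face_ray (p d : plane) : d != 0 ->
  (forall t : R, 0 <= t -> ~ D (p + t *: d)) -> F p.
Proof.
move=> d0 H; have pE : p + 0 *: d = p by rewrite scale0r addr0.
split; first by rewrite -pE; apply: H.
move=> Cb; apply: (@ray_unbounded R p d d0).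
apply: sub_boundedr Cb => A CA x Ax; apply: CA.
apply: (@connected_component_max _ _
  ((fun t : R => p + t *: d) @` `[0, +oo[)) => //.
- by exists 0; rewrite //= in_itv /= lexx.
- by move=> _ [t tin <-]; apply: H; move: tin; rewrite /= in_itv /= andbT.
- exact: ray_connected.
Qed.

Lemma outer_face_segment (p q : plane) :
  segment p q `<=` ~` D -> F q -> F p.
Proof.
move=> pqD [_ Fq]; have pp : segment p q p.
  by apply/segmentP; exists 0; rewrite ?lexx ?ler01// scale0r addr0.
split; first exact: pqD.
rewrite (@same_connected_component _ _ p q)//.
exists (segment p q); first by split => //; exact: segment_connected.
by apply/segmentP; exists 1; rewrite ?lexx ?ler01// scale1r addrCA subrr addr0.
Qed.

End OuterFace.

(** * Vertices on the unit circle: escaping through an empty sector *)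

Section Escape.
Variables (R : realType) (V : finType) (adj : rel V) (pos : V -> R * R).
Local Notation plane := (R * R)%type.
Local Notation D := (drawing_union adj pos).
Local Notation F := (outer_face adj pos).

Hypothesis adj_sym : symmetric adj.
Hypothesis pos_unit : forall u, dot (pos u) (pos u) = 1.
Hypothesis pos_dot : forall u w, w != u -> dot (pos w) (pos u) < 1.

(* Taking a = b includes the vertices other than u themselves. *)
Definition avoiding (u : V) : set plane :=
  [set x | exists a b, [/\ a != u, b != u, (a == b) || adj a b
                         & segment (pos a) (pos b) x]].

(** The sign of e selects a side of the line uv, so that one argument serves both sides. *)
Definition one_sided (u v : V) (e : R) : Prop :=
  forall w, adj u w -> w != v -> 0 < e * orient (pos u) (pos v) (pos w).

Lemma avoiding_closed u : closed (avoiding u).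
Proof.
have -> : avoiding u = \bigcup_(ab in [set` [pred ab : V * V | [&& ab.1 != u,
    ab.2 != u & (ab.1 == ab.2) || adj ab.1 ab.2]]])
    segment (pos ab.1) (pos ab.2).
  apply/seteqP; split=> [x [a [b [au bu ab xab]]]|x [[a b]]].
    by exists (a, b) => //=; rewrite inE /= au bu.
  by rewrite /= inE /= => /and3P[au bu ab] xab; exists a, b.
by apply: closed_bigcup => // ab _; exact: segment_closed.
Qed.

Lemma dot_segment (p q x c : plane) (m : R) : segment p q x ->
  dot p c <= m -> dot q c <= m -> dot x c <= m.
Proof.
move=> /segmentP[t /andP[t0 t1] ->] pm qm.
have -> : dot (p + t *: (q - p)) c = (1 - t) * dot p c + t * dot q c.
  by rewrite lineE /dot /=; ring.
nra.
Qed.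

(** A linear form on a segment is bounded by its values at the ends, so m can be a maximum over the
    finitely many vertices other than u. *)
Lemma avoiding_dot u :
  exists2 m : R, m < 1 & forall x, avoiding u x -> dot x (pos u) <= m.
Proof.
(* The default 0 is itself below 1, which also settles the case of a single vertex. *)
exists (\big[Num.max/0]_(w | w != u) dot (pos w) (pos u)).
  by apply: bigmax_lt => // w; exact: pos_dot.
move=> x [a [b [au bu _ xab]]].
apply: dot_segment xab _ _.
  exact: (le_bigmax_cond _ (fun w => dot (pos w) (pos u))).
exact: (le_bigmax_cond _ (fun w => dot (pos w) (pos u))).
Qed.

Lemma orient_segment (u v w : V) (x : plane) : segment (pos u) (pos w) x ->
  exists2 t : R, 0 <= t & x = pos u + t *: (pos w - pos u) /\
    orient (pos u) (pos v) x = t * orient (pos u) (pos v) (pos w).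
Proof.
move=> /segmentP[t /andP[t0 _] ->]; exists t => //; split=> //.
by rewrite lineE /orient /=; ring.
Qed.

(** Orientation with respect to uv grows linearly along uw from the value 0 at u, so only u itself
    escapes the strict inequality. *)
Lemma one_sided_segment u v w e x : one_sided u v e -> adj u w -> w != v ->
  segment (pos u) (pos w) x -> e * orient (pos u) (pos v) x <= 0 -> x = pos u.
Proof.
move=> uve uw wv /(orient_segment v)[t t0 [-> ->]] le0.
move: t0; rewrite le_eqVlt => /predU1P[<-|t0]; first by rewrite scale0r addr0.
have := uve _ uw wv; move: le0.
rewrite mulrCA pmulr_rle0// => /le_lt_trans/[apply].
by rewrite ltxx.
Qed.

(** A drawn point outside [avoiding u] is u or lies on an edge at u. Such an edge either runs
    strictly on the positive side or is uv, where the orientation vanishes. *)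
Lemma not_drawn u v e x : one_sided u v e -> ~ avoiding u x -> x <> pos u ->
    e * orient (pos u) (pos v) x <= 0 ->
    (adj u v -> e * orient (pos u) (pos v) x < 0) ->
  ~ D x.
Proof.
move=> uve xA xu le0 lt0.
have key w : adj u w -> ~ segment (pos u) (pos w) x.
  move=> uw xuw; have [wv|wv] := eqVneq w v; last first.
    exact/xu/(one_sided_segment uve uw wv).
  move: uw xuw; rewrite wv => uv /(orient_segment v)[t _ [_]].
  have -> : orient (pos u) (pos v) (pos v) = 0 by rewrite /orient; ring.
  by rewrite mulr0 => x0; have := lt0 uv; rewrite x0 mulr0 ltxx.
case=> [[w _ wx]|[a [b [ab xab]]]].
  have [wu|wu] := eqVneq w u; first by apply: xu; rewrite -wx wu.
  by apply: xA; exists w, w; rewrite eqxx wu segmentxx; split.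
have [au|au] := eqVneq a u; first by apply: (key b); rewrite -au.
have [bu|bu] := eqVneq b u.
  by apply: (key a); rewrite -bu; [rewrite adj_sym|rewrite segment_sym].
by apply: xA; exists a, b; split => //; rewrite ab orbT.
Qed.

(* When [one_sided u v e] holds, t > 0 moves off the line uv to the side without
   neighbours of u, parallel to the tangent of the unit circle at u. *)
Definition sweep (u v : V) (e s t : R) : plane :=
  pos u + s *: (pos v - pos u) + t *: tangent (pos u) e.

(** The tangent at u is orthogonal to u, so the value does not depend on t: a tangential ray
    starting above the level m of [avoiding_dot] stays above it. *)
Lemma dot_sweep u v e s t :
  dot (sweep u v e s t) (pos u) = 1 - s * (1 - dot (pos v) (pos u)).
Proof.
rewrite -{1 2}(pos_unit u) /sweep !lineE /dot /=; ring.
Qed.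

Lemma orient_sweep u v e s t : orient (pos u) (pos v) (sweep u v e s t) =
  - (t * e * (1 - dot (pos v) (pos u))).
Proof.
rewrite -(pos_unit u) /sweep !lineE /dot /orient /=; ring.
Qed.

Lemma sweep_not_drawn u v e s t : v != u -> e != 0 -> one_sided u v e ->
  0 < s -> 0 <= t -> (adj u v -> 0 < t) -> ~ avoiding u (sweep u v e s t) ->
  ~ D (sweep u v e s t).
Proof.
move=> vu e0 uve s0 t0 at0 nA; have k0 := pos_dot vu.
have e2 : 0 < e * e by rewrite -expr2 exprn_even_gt0.
have oE : e * orient (pos u) (pos v) (sweep u v e s t) =
    - (t * (e * e * (1 - dot (pos v) (pos u)))).
  by rewrite orient_sweep; ring.
have c0 : 0 < e * e * (1 - dot (pos v) (pos u)) by rewrite mulr_gt0// subr_gt0.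
apply: (not_drawn uve) => //.
- move=> E; have := dot_sweep u v e s t; rewrite E pos_unit; nra.
- by rewrite oE oppr_le0 mulr_ge0// ltW.
- by move=> /at0 t1; rewrite oE oppr_lt0 mulr_gt0.
Qed.

Lemma tangent_neq0 u (e : R) : e != 0 -> tangent (pos u) e != 0.
Proof.
move=> e0; apply/eqP => -[/eqP + /eqP].
rewrite oppr_eq0 !mulf_eq0 (negPf e0) /=.
move=> /eqP y0 /eqP x0; have := pos_unit u; rewrite /dot x0 y0 !mulr0 addr0.
by move/eqP; rewrite eq_sym oner_eq0.
Qed.

Lemma escape u v e : v != u -> e != 0 -> one_sided u v e ->
  exists2 s0 : R, 0 < s0 & forall s t, 0 < s <= s0 ->
    ~ avoiding u (sweep u v e s t) /\
    (0 <= t -> (adj u v -> 0 < t) -> F (sweep u v e s t)).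
Proof.
move=> vu e0 uve; have [m m1 mA] := avoiding_dot u; have k0 := pos_dot vu.
pose k := 1 - dot (pos v) (pos u).
have {}k0 : 0 < k by rewrite subr_gt0.
(* At s = (1 - m) / k the level 1 - s k would equal m; half of this parameter keeps it strictly
   above m. *)
exists ((1 - m) / (k + k)); first by apply: divr_gt0; lra.
move=> s t /andP[s0 s1].
have sA t' : ~ avoiding u (sweep u v e s t').
  move=> /mA; rewrite dot_sweep -/k.
  have : s * (k + k) <= 1 - m by rewrite -ler_pdivlMr//; lra.
  nra.
split=> // t0 ut.
apply: (@outer_face_ray _ _ _ _ _ (tangent (pos u) e)); first exact: tangent_neq0.
move=> t' t'0; rewrite -addrA -scalerDl -/(sweep u v e s (t + t')).
apply: sweep_not_drawn => //; first exact: addr_ge0.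
by move=> /ut; lra.
Qed.

Lemma nonedge_meets_outer u v e : v != u -> e != 0 -> one_sided u v e ->
  ~~ adj u v -> segment (pos u) (pos v) `&` F !=set0.
Proof.
move=> vu e0 uve nuv; have [s0 s00 H] := escape vu e0 uve.
(* The cap at 1 keeps the point on the segment uv. As uv is not an edge, t = 0 is allowed in
   [escape]. *)
pose s := Num.min s0 1.
have s1 : 0 < s by rewrite lt_min s00 ltr01.
exists (sweep u v e s 0); split; last first.
  apply: (H _ _ _).2 => //; last by rewrite (negPf nuv).
  by rewrite s1 ge_min lexx.
rewrite /sweep scale0r addr0; apply/segmentP; exists s => //.
by rewrite ltW //= ge_min lexx orbT.
Qed.

Lemma sweep_continuous u v e :
  continuous (fun st : R * R => sweep u v e st.1 st.2).
Proof.
move=> [s t]; apply: cvgD; first apply: cvgD; first exact: cvg_cst.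
  by apply: cvgZr_tmp; exact: cvg_fst.
by apply: cvgZr_tmp; exact: cvg_snd.
Qed.

(* Tube lemma on a compact part of the edge uv. *)
Lemma sweep_strip u v e (a b : R) :
  (forall s, a <= s <= b -> ~ avoiding u (sweep u v e s 0)) ->
  \forall t \near (0 : R),
    forall s, a <= s <= b -> ~ avoiding u (sweep u v e s t).
Proof.
move=> H; have /compact_near_coveringP K := @segment_compact R a b.
have : \forall t \near (0 : R),
    `[a, b]%classic `<=` (fun s => ~ avoiding u (sweep u v e s t)).
  apply: (K R (nbhs (0 : R)) (fun t s => ~ avoiding u (sweep u v e s t))) => s.
  rewrite /= in_itv /= => /H nA.
  have := @sweep_continuous u v e (s, 0) (~` avoiding u).
  apply; apply: open_nbhs_nbhs; split => //.
  exact/closed_openC/avoiding_closed.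
by apply: filterS => t Ht s sab; apply: Ht; rewrite /= in_itv.
Qed.

Lemma sweep_continuousl u v e t : continuous (fun s => sweep u v e s t).
Proof.
move=> s; apply: cvgD; last exact: cvg_cst.
by apply: cvgD; [exact: cvg_cst|apply: cvgZr_tmp; exact: cvg_id].
Qed.

Lemma sweep_continuousr u v e s : continuous (sweep u v e s).
Proof.
by move=> t; apply: cvgD; [exact: cvg_cst|apply: cvgZr_tmp; exact: cvg_id].
Qed.

(** For small t > 0, the part of uv between a and s1, shifted by t, is undrawn by [sweep_strip]. It
    joins its end over s1 to its end over a, which is in the outer face by [escape]. Then t tends to
    0. *)
Lemma closure_sweep u v e (s1 : R) : v != u -> e != 0 -> one_sided u v e ->
  0 < s1 -> (forall s, 0 < s <= s1 -> ~ avoiding u (sweep u v e s 0)) ->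
  closure F (sweep u v e s1 0).
Proof.
move=> vu e0 uve s10 nA; have [s0 s00 H] := escape vu e0 uve.
pose a := Num.min s0 s1.
have a0 : 0 < a by rewrite lt_min s00.
have as0 : a <= s0 by rewrite ge_min lexx.
have as1 : a <= s1 by rewrite ge_min lexx orbT.
have strip : \forall t \near (0 : R), forall s, a <= s <= s1 ->
    ~ avoiding u (sweep u v e s t).
  apply: sweep_strip => s /andP[as_ ss1]; apply: nA.
  by rewrite ss1 andbT (lt_le_trans a0).
have Fs1 : \forall t \near 0^'+, closure F (sweep u v e s1 t).
  near=> t; have t0 : 0 < t by near: t; exact: nbhs_right_gt.
  apply: subset_closure; apply: (@outer_face_segment _ _ _ _ _ (sweep u v e a t)).
    have st : forall s, a <= s <= s1 -> ~ avoiding u (sweep u v e s t).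
      by near: t; exact: (cvg_within _ strip).
    move=> _ /segmentP[r /andP[r0 r1] ->].
    have -> : sweep u v e s1 t + r *: (sweep u v e a t - sweep u v e s1 t) =
        sweep u v e (s1 + r * (a - s1)) t.
      by rewrite /sweep !lineE; congr pair => /=; ring.
    have le_s : a <= s1 + r * (a - s1) <= s1 by apply/andP; split; nra.
    apply: sweep_not_drawn => //; last exact: st.
      by case/andP: le_s => + _; exact: lt_le_trans.
  apply: (H a t _).2; [by rewrite a0|exact: ltW|by []].
apply: (closed_cvg (closure F) _ Fs1); first exact: closed_closure.
apply: cvg_at_right_filter.
exact: sweep_continuousr.
Unshelve. all: by end_near. Qed.

(** By [escape] there is no hit up to s0. The hits in [s0, 1] form a compact set, nonempty because v
    itself belongs to [avoiding u], and s1 is its minimum. *)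
Lemma first_hit u v e : v != u -> e != 0 -> one_sided u v e ->
  exists2 s1 : R, 0 < s1 <= 1 & avoiding u (sweep u v e s1 0) /\
    forall s, 0 < s < s1 -> ~ avoiding u (sweep u v e s 0).
Proof.
move=> vu e0 uve; have [s0 s00 H] := escape vu e0 uve.
pose f s := sweep u v e s 0.
have fc : continuous f by exact: sweep_continuousl.
have f0 s : f s = pos u + s *: (pos v - pos u).
  by rewrite /f /sweep scale0r addr0.
pose Q := `[s0, 1]%classic `&` f @^-1` avoiding u.
have Qc : compact Q.
  apply: compact_closedI; first exact: segment_compact.
  by apply: (continuous_closedP f).1 => //; exact: avoiding_closed.
have Q1 : Q 1.
  have f1 : avoiding u (f 1).
    exists v, v; rewrite eqxx segmentxx; split=> //=.
    by rewrite f0 scale1r subrKC.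
  split=> //; rewrite /= in_itv /= lexx andbT leNgt; apply/negP => s01.
  by case: (H 1 0); rewrite // ltr01 ltW.
have [] := @compact_EVT_min _ R id Q _ Qc; first by exists 1.
  by apply: continuous_subspaceT => s; exact: cvg_id.
move=> s1; rewrite inE => -[/= s11 fs1] s1_min; exists s1.
  move: s11; rewrite in_itv /= => /andP[s01 ->]; rewrite andbT.
  exact: lt_le_trans s01.
split=> // s /andP[sgt0 ss1] As; have [ss0|ss0] := leP s s0.
  by case: (H s 0) => //; rewrite sgt0.
have : s1 <= s.
  apply: s1_min; rewrite inE; split=> //=; rewrite in_itv /= ltW//=.
  move: s11; rewrite in_itv /= => /andP[_]; apply: le_trans; exact: ltW.
by rewrite leNgt ss1.
Qed.

Lemma sweep0 u v e s : sweep u v e s 0 = pos u + s *: (pos v - pos u).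
Proof. by rewrite /sweep scale0r addr0. Qed.

Lemma sweep_neq u v e s : v != u -> 0 < s -> sweep u v e s 0 <> pos u.
Proof.
move=> /pos_dot k0 s0 E; have := dot_sweep u v e s 0; rewrite E pos_unit; nra.
Qed.

(** The piece runs from u to the first hit. It consists of drawn points, hence misses the interior
    of the outer face, and [closure_sweep] puts it in the closure. *)
Lemma edge_piece u v e : v != u -> e != 0 -> one_sided u v e -> adj u v ->
  exists p q, planarization_piece adj pos u v p q /\
    segment p q `<=` boundary F.
Proof.
move=> vu e0 uve uv; have [s1 /andP[s10 s11] [As1 nA]] := first_hit vu e0 uve.
pose P s := sweep u v e s 0.
have P0 : P 0 = pos u by rewrite /P sweep0 scale0r addr0.
have clP r : 0 < r < s1 -> closure F (P r).
  move=> /andP[r0 rs1]; apply: (closure_sweep vu e0 uve) => // s /andP[s0 sr].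
  by apply: nA; rewrite s0 (le_lt_trans sr).
have Puv r : 0 <= r <= s1 -> segment (pos u) (pos v) (P r).
  move=> /andP[r0 rs1]; apply/segmentP; exists r; last exact: sweep0.
  by rewrite r0 (le_trans rs1).
have segP x : segment (pos u) (P s1) x -> exists2 r, 0 <= r <= s1 & x = P r.
  move=> /segmentP[t /andP[t0 t1] ->]; exists (t * s1).
    by rewrite mulr_ge0 ?(ltW s10)// ger_pMl.
  by rewrite /P !sweep0 !lineE; congr pair => /=; ring.
exists (pos u), (P s1); split; last first.
  move=> x /segP[r /andP[r0 rs1] ->]; split; last first.
    move=> /interior_subset[+ _]; apply; right; exists u, v; split=> //.
    by apply: Puv; rewrite r0.
  (* [clP] covers the open piece; its two ends are reached as one-sided limits. *)
  have [r0'|r0'] := eqVneq r 0.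
    rewrite r0';
    apply: (@closed_cvg _ _ 0^'+ _ P (closure F) (@closed_closure _ F)).
      near=> s; apply: clP; apply/andP; split; near: s.
        exact: nbhs_right_gt.
      exact: nbhs_right_lt.
    exact/cvg_at_right_filter/sweep_continuousl.
  have {}r0 : 0 < r by rewrite lt_neqAle eq_sym r0'.
  move: rs1; rewrite le_eqVlt => /predU1P[->|rs1]; last by apply: clP; rewrite r0.
  apply: (@closed_cvg _ _ s1^'- _ P (closure F) (@closed_closure _ F)).
    near=> s; apply: clP; apply/andP; split; near: s; last exact: nbhs_left_lt.
    exact: nbhs_left_gt.
  exact/cvg_at_left_filter/sweep_continuousl.
(* Inside the piece no other edge passes: those at u leave the line uv at once, and those avoiding u
   do not occur before s1. *)
have only_uv r a b : 0 < r < s1 -> adj a b -> segment (pos a) (pos b) (P r) ->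
    [set a; b]%SET = [set u; v]%SET.
  move=> /andP[r0 rs1] ab xab.
  have key w : adj u w -> segment (pos u) (pos w) (P r) -> w = v.
    move=> uw xuw; apply/eqP/negPn/negP => wv.
    apply: (sweep_neq (e := e) vu r0); apply: (one_sided_segment uve uw wv) => //.
    by rewrite orient_sweep !mul0r oppr0 mulr0.
  have [au|au] := eqVneq a u; first by rewrite au (key b) -?au.
  have [bu|bu] := eqVneq b u.
    by rewrite bu finset.setUC (key a) // -bu;
      [rewrite adj_sym|rewrite segment_sym].
  by case: (nA r); [rewrite r0|exists a, b; rewrite ab orbT].
split.
- by apply/eqP => /esym; exact: sweep_neq.
- move=> x /segP[r r01 ->]; exact: Puv.
apply/seteqP; split=> [x [/segP[r /andP[r0 rs1] ->]]|x].
  have [->|r0'] := eqVneq r 0; first by rewrite P0; left.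
  have {}r0 : 0 < r by rewrite lt_neqAle eq_sym r0'.
  move: rs1; rewrite le_eqVlt => /predU1P[->|rs1]; first by right.
  have r01 : 0 < r < s1 by rewrite r0.
  case=> [[w _ wx]|[a [b [a' [b' [ab ab' + xab xab']]]]]].
    have [wu|wu] := eqVneq w u.
      by case: (sweep_neq (e := e) vu r0); rewrite -/(P r) -wx wu.
    case: (nA r) => //; exists w, w; rewrite eqxx wu segmentxx; split=> //.
  by rewrite (only_uv r a b)// (only_uv r a' b')// eqxx.
have Pseg r : 0 <= r <= s1 -> segment (pos u) (P s1) (P r).
  move=> /andP[r0 rs1]; apply/segmentP; exists (r / s1).
    by rewrite divr_ge0 ?(ltW s10)//= ler_pdivrMr// mul1r.
  rewrite /P !sweep0 [_ + s1 *: _ - _]addrAC subrr add0r scalerA.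
  by rewrite divfK// gt_eqF.
case=> ->.
  split; first by rewrite -{2}P0; apply: Pseg; rewrite lexx ltW.
  by left; exists u.
split; first by apply: Pseg; rewrite lexx ltW.
(* The first hit is a vertex or lies on an edge ab that avoids u. Such an edge differs from uv, so
   the hit is a crossing. *)
case: As1 => a [b [au bu /predU1P[->|ab] xab]].
  by left; exists b => //; move: xab; rewrite segmentxx /= => <-.
right; exists u, v, a, b; split=> //; last by apply: Puv; rewrite lexx ltW.
apply/eqP => /setP /(_ u); rewrite !finset.inE eqxx /=.
by rewrite !(eq_sym u) (negPf au) (negPf bu).
Unshelve. all: by end_near. Qed.

Lemma one_sided_reducible_oor :
  irreflexive adj ->
  (forall u v, u != v -> exists2 e : R, e != 0 &
     one_sided u v e \/ one_sided v u e) ->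
  oor adj pos /\ reducible_drawing adj pos.
Proof.
move=> irr side; split; first split.
- move=> u w E; apply/eqP/negPn/negP => uw.
  by have := pos_dot uw; rewrite E pos_unit ltxx.
(* The form [dot _ (pos w)] is 1 at w and less than 1 at all other vertices, so w is on no segment
   between two of them. *)
- move=> u v w uv /(dot_segment (c := pos w)) H.
  have [->|wu] := eqVneq w u; first by left.
  have [->|wv] := eqVneq w v; first by right.
  have := H (Num.max (dot (pos u) (pos w)) (dot (pos v) (pos w))).
  rewrite !le_max !lexx orbT /= => /(_ isT isT); rewrite -le_max leNgt.
  by rewrite pos_unit gt_max !pos_dot // eq_sym.
- move=> u v uv nuv; have [e e0 [uve|vue]] := side _ _ uv.
    by apply: (nonedge_meets_outer _ e0 uve) => //; rewrite eq_sym.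
  by rewrite segment_sym; apply: (nonedge_meets_outer _ e0 vue);
    rewrite // adj_sym.
move=> u v uv; have uv' : u != v by apply: contraTneq uv => ->; rewrite irr.
have [e e0 [uve|vue]] := side _ _ uv'.
  by apply: (edge_piece _ e0 uve) => //; rewrite eq_sym.
have [|p [q [[pq pqvu pqPV] pqF]]] := edge_piece uv' e0 vue.
  by rewrite adj_sym.
by exists p, q; split=> //; split=> //; rewrite [X in _ `<=` X]segment_sym.
Qed.

End Escape.

(** * Inscribed triangles and the corners of the regular polygon *)

Section Circle.
Variable R : realType.

Definition circle_point (x : R) : R * R := (cos (x *+ 2), sin (x *+ 2)).

Lemma dot_circle_point x y :
  dot (circle_point x) (circle_point y) = 1 - sin (x - y) ^+ 2 *+ 2.
Proof.
rewrite /dot /circle_point /= -cosB -mulrnBl cos_mulr2n.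
rewrite -{1 2}(cos2Dsin2 (x - y)); ring.
Qed.

(** Signed form of the area 2 sin A sin B sin C of a triangle inscribed in the unit circle; the
    orientation is twice that area. *)
Lemma orient_circle_point x y z :
  orient (circle_point x) (circle_point y) (circle_point z) =
  4 * (sin (y - x) * sin (z - y) * sin (z - x)).
Proof.
set a := y - x; set b := z - y; have -> : z - x = a + b by rewrite /a /b; ring.
transitivity (sin (a *+ 2) + sin (b *+ 2) - sin ((a + b) *+ 2)).
  have -> : (a + b) *+ 2 = z *+ 2 - x *+ 2 by rewrite /a /b; ring.
  by rewrite /a /b !mulrnBl !sinB /orient /circle_point /=; ring.
rewrite !sin_mulr2n sinD cosD.
have := cos2Dsin2 a; have := cos2Dsin2 b.
move: (cos a) (sin a) (cos b) (sin b) => ca sa cb sb Eb Ea.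
(* The squares are grouped so that cos^2 + sin^2 = 1 turns each bracket into twice a squared
   sine. *)
transitivity (ca * sa * (1 - cb ^+ 2 + sb ^+ 2) *+ 2 +
              cb * sb * (1 - ca ^+ 2 + sa ^+ 2) *+ 2); first ring.
have -> : 1 - cb ^+ 2 + sb ^+ 2 = sb ^+ 2 *+ 2 by rewrite -Eb; ring.
have -> : 1 - ca ^+ 2 + sa ^+ 2 = sa ^+ 2 *+ 2 by rewrite -Ea; ring.
ring.
Qed.

(* [circle_point] doubles its argument, so that [dot] and [orient] factor into
   sines of differences lying in ]0, pi[. *)
Definition half_angle (n i : nat) : R := pi * i%:R / n%:R.

Lemma sin_half_angle_gt0 n i j : (i < j)%N -> (j < n)%N ->
  0 < sin (half_angle n j - half_angle n i).
Proof.
move=> ij jn; have n0 : (0 : R) < n%:R by rewrite ltr0n (leq_trans _ jn).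
have -> : half_angle n j - half_angle n i = pi * (j - i)%:R / n%:R.
  by rewrite /half_angle natrB 1?ltnW// mulrBr mulrBl.
apply: sin_gt0_pi; apply/andP; split.
  by rewrite divr_gt0// mulr_gt0 ?pi_gt0// ltr0n subn_gt0.
rewrite ltr_pdivrMr// ltr_pM2l ?pi_gt0// ltr_nat.
by rewrite (leq_ltn_trans (leq_subr _ _)).
Qed.

Definition vertex (n i : nat) : R * R := circle_point (half_angle n i).

Lemma dot_vertex n i : dot (vertex n i) (vertex n i) = 1.
Proof. by rewrite dot_circle_point subrr sin0 expr0n mul0rn subr0. Qed.

Lemma dot_vertex_lt1 n i j : (i < n)%N -> (j < n)%N -> i != j ->
  dot (vertex n i) (vertex n j) < 1.
Proof.
move=> i_n j_n; rewrite dot_circle_point gtrBl pmulrn_lgt0// neq_ltn.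
rewrite exprn_even_gt0//= => /orP[ij|ij].
  by rewrite -oppr_eq0 -sinN opprB gt_eqF// sin_half_angle_gt0.
by rewrite gt_eqF// sin_half_angle_gt0.
Qed.

Lemma orient_vertex_gt0 n i j m : (i < j)%N -> (j < m)%N -> (m < n)%N ->
  0 < orient (vertex n i) (vertex n j) (vertex n m).
Proof.
move=> ij jm mn; rewrite orient_circle_point mulr_gt0// !mulr_gt0//.
- exact/sin_half_angle_gt0/(ltn_trans jm).
- exact: sin_half_angle_gt0.
- by apply: sin_half_angle_gt0 => //; exact: ltn_trans jm.
Qed.

Lemma orientC (p q r : R * R) : orient p q r = - orient p r q.
Proof. by rewrite /orient; ring. Qed.

Lemma orient_rot (p q r : R * R) : orient p q r = orient q r p.
Proof. by rewrite /orient; ring. Qed.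

Definition ccw (i j m : nat) := [|| i < j < m, j < m < i | m < i < j]%N.

Lemma orient_ccw n i j m : (i < n)%N -> (j < n)%N -> (m < n)%N -> ccw i j m ->
  0 < orient (vertex n i) (vertex n j) (vertex n m).
Proof.
move=> i_n jn mn /or3P[] /andP[a b].
- exact: orient_vertex_gt0.
- by rewrite orient_rot; exact: orient_vertex_gt0.
- by rewrite 2!orient_rot; exact: orient_vertex_gt0.
Qed.

Lemma ngon_pointE n i :
  ngon_point 0 1 0 n i = vertex n i :> R * R.
Proof.
rewrite /ngon_point add0r scale1r add0r.
rewrite /vertex /circle_point.
have -> // : half_angle n i *+ 2 = 2 * pi * i%:R / n%:R.
by rewrite /half_angle; ring.
Qed.

End Circle.

(** * From an injective key to a regular placement *)

Section Rank.
Variables (R : realType) (V : finType) (key : V -> nat).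
Hypothesis key_inj : injective key.

(** Keys may leave gaps; ranks keep their order and take each value below #|V| exactly once, as the
    corners of the polygon require. *)
Definition rank (v : V) : nat := #|[set w | (key w < key v)%N]%SET|.

Lemma ltn_rank u v : (rank u < rank v)%N = (key u < key v)%N.
Proof.
have mono x y : (key x < key y)%N -> (rank x < rank y)%N.
  move=> xy; apply/proper_card/properP; split.
    by apply/fintype.subsetP => w; rewrite !finset.inE => /ltn_trans; apply.
  by exists x; rewrite !finset.inE ?xy// ltnn.
apply/idP/idP; last exact: mono.
apply: contraTT; rewrite -!leqNgt leq_eqVlt => /predU1P[/key_inj ->//|].
by move/mono/ltnW.
Qed.

Lemma rank_inj : injective rank.
Proof.
move=> u v E; apply: key_inj; apply/eqP.
by have := ltn_rank u v; have := ltn_rank v u; rewrite E ltnn; lia.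
Qed.

Lemma rank_lt v : (rank v < #|V|)%N.
Proof.
rewrite -cardsT; apply/proper_card/properP; split; first exact: finset.subsetT.
by exists v; rewrite !finset.inE ?ltnn.
Qed.

Definition circular_placement (v : V) : R * R := vertex R #|V| (rank v).

Lemma circular_placement_regular : regular_placement circular_placement.
Proof.
exists 0, 1, 0; split; first exact: ltr01.
apply/seteqP; split=> [_ [v _ <-]|_ [i /= iV <-]].
  by exists (rank v) => /=; rewrite ?rank_lt// ngon_pointE.
have rI : injective (fun v => Ordinal (rank_lt v)).
  by move=> u v /(congr1 val)/rank_inj.
have [|g _ gK] := inj_card_bij rI; first by rewrite card_ord.
exists (g (Ordinal iV)) => //.
by rewrite ngon_pointE /circular_placement [rank _](congr1 val (gK (Ordinal iV))).
Qed.

Lemma orient_circular_placement u v w : ccw (key u) (key v) (key w) ->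
  0 < orient (circular_placement u) (circular_placement v) (circular_placement w).
Proof. by rewrite /ccw -!ltn_rank; apply: orient_ccw; exact: rank_lt. Qed.

(** This reduces the geometry to the cyclic order of the keys, since that order determines
    orientations on the circle. *)
Lemma circular_placement_reducible_oor (adj : rel V) :
  symmetric adj -> irreflexive adj ->
  (forall u v, u != v -> exists x y,
    [/\ (x = u /\ y = v) \/ (x = v /\ y = u) &
      (forall w, adj x w -> w != y -> ccw (key x) (key y) (key w)) \/
      (forall w, adj x w -> w != y -> ccw (key x) (key w) (key y))]) ->
  reducible_regular_oor adj circular_placement.
Proof.
move=> adj_sym irr side.
have [] // := @one_sided_reducible_oor R V adj circular_placement adj_sym.
- by move=> u; exact: dot_vertex.
- by move=> u w wu; apply: dot_vertex_lt1; rewrite ?rank_lt// (inj_eq rank_inj).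
- move=> u v /side[x [y [xy H]]].
  (* Take e = 1 if the neighbours lie to the left of the line from x to y, and e = -1 if they lie to
     the right. *)
  have [e e0 xye] : exists2 e : R, e != 0 &
      one_sided adj circular_placement x y e.
    case: H => H; [exists 1; first exact: oner_neq0|exists (-1)].
    + move=> w xw wy; rewrite mul1r.
      by apply: orient_circular_placement; exact: H.
    + by rewrite oppr_eq0 oner_neq0.
    + move=> w xw wy; rewrite orientC mulrNN mul1r.
      by apply: orient_circular_placement; exact: H.
  by exists e => //; case: xy => -[<- <-]; [left|right].
- by split=> //; exact: circular_placement_regular.
Qed.

End Rank.

(** * The chessboard order on the grid *)

Definition grid_near (a b a' b' : nat) : bool :=
  ((a == a') && ((b' == b.+1) || (b == b'.+1))) ||
  ((b == b') && ((a' == a.+1) || (a == a'.+1))).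

Lemma grid_adjE k l (u v : 'I_k * 'I_l) :
  grid_adj u v = grid_near u.1 u.2 v.1 v.2.
Proof. by rewrite /grid_adj /grid_near; apply/idP/idP; lia. Qed.

Lemma lex_ltn (k x y x' y' : nat) : (x < k)%N ->
  (y < y')%N || (y == y') && (x < x')%N -> (y * k + x < y' * k + x')%N.
Proof.
move=> xk /orP[yy'|/andP[/eqP -> xx']]; last by rewrite ltn_add2l.
apply: (@leq_trans (y.+1 * k)); first by rewrite mulSn addnC ltn_add2r.
by apply: leq_trans (leq_addr _ _); rewrite leq_mul2r yy' orbT.
Qed.

(** Neighbours of (a, b) have second coordinate at most b + 1, and only (a, b + 1) attains it. So a
    neighbour can come after (c, d) only if d = b + 1 and c < a. *)
Lemma near_lex_lt (k a b c d a' b' : nat) :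
  (a' < k)%N -> grid_near a b a' b' -> (a', b') != (c, d) ->
  (b < d)%N -> ~~ ((d == b.+1) && (c < a)%N) ->
  (b' * k + a' < d * k + c)%N.
Proof.
by rewrite /grid_near xpair_eqE => a'k nr ne bd ex; apply: lex_ltn => //; lia.
Qed.

Lemma near_lex_gt (k a b c d a' b' : nat) :
  (c < k)%N -> grid_near a b a' b' -> (a', b') != (c, d) ->
  (d < b)%N -> ~~ ((b == d.+1) && (a < c)%N) ->
  (d * k + c < b' * k + a')%N.
Proof.
by rewrite /grid_near xpair_eqE => ck nr ne db ex; apply: lex_ltn => //; lia.
Qed.

(** Lexicographic order is encoded by two-digit numerals; the offset k * l puts the odd class after
    the even one. *)
Definition grid_key (k l : nat) (v : 'I_k * 'I_l) : nat :=
  (if odd (v.1 + v.2) then k * l + (v.2 * k + v.1) else v.1 * l + v.2)%N.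

Section GridKey.
Variables k l : nat.
Implicit Types u v w : 'I_k * 'I_l.
Local Notation key := (@grid_key k l).
Local Notation adj := (@grid_adj k l).
Local Notation odd_v v := (odd (v.1 + v.2))%N.

Lemma grid_key_even v : ~~ odd_v v -> (key v < k * l)%N.
Proof.
rewrite /grid_key => /negPf ->;
(* The bound k * l is read as the numeral with digits k and 0. *)
have := lex_ltn (k := l) (x := v.2) (y := v.1) (x' := 0) (y' := k).
by rewrite !ltn_ord addn0; apply.
Qed.

Lemma grid_key_odd v : odd_v v -> (k * l <= key v)%N.
Proof. by rewrite /grid_key => ->; exact: leq_addr. Qed.

Lemma odd_grid_adj u v : adj u v -> odd_v v = ~~ odd_v u.
Proof. by rewrite grid_adjE /grid_near; lia. Qed.

Lemma lex_inj (m x y x' y' : nat) : (x < m)%N -> (x' < m)%N ->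
  (y * m + x = y' * m + x')%N -> x = x' /\ y = y'.
Proof.
move=> xm x'm E; have m0 : (0 < m)%N by apply: leq_trans xm.
split; first by have := congr1 (modn^~ m) E; rewrite !modnMDl !modn_small.
by have := congr1 (divn^~ m) E; rewrite !divnMDl// !divn_small// !addn0.
Qed.

Lemma grid_key_inj : injective key.
Proof.
move=> u v E; have [ou|ou] := boolP (odd_v u); have [ov|ov] := boolP (odd_v v).
- move: E; rewrite /grid_key ou ov => /addnI/lex_inj[]// E1 E2.
  by apply: injective_projections; exact: val_inj.
- by have := grid_key_odd ou; rewrite E leqNgt grid_key_even.
- by have := grid_key_odd ov; rewrite -E leqNgt grid_key_even.
- move: E; rewrite /grid_key (negPf ou) (negPf ov) => /lex_inj[]// E1 E2.
  by apply: injective_projections; exact: val_inj.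
Qed.

Definition extremal u v : Prop :=
  (forall w, adj u w -> w != v -> ccw (key u) (key v) (key w)) \/
  (forall w, adj u w -> w != v -> ccw (key u) (key w) (key v)).

(** All neighbours of u are in the other class, which fills an arc free of u and v and hence lies on
    one side of uv. *)
Lemma extremal_same_class u v : u != v -> odd_v u = odd_v v -> extremal u v.
Proof.
rewrite -(inj_eq grid_key_inj) neq_ltn => uv ouv.
have [ou|ou] := boolP (odd_v u).
  have [ku kv] : (k * l <= key u /\ k * l <= key v)%N.
    by split; apply: grid_key_odd; rewrite -?ouv.
  have kw w : adj u w -> (key w < k * l)%N.
    by move=> /odd_grid_adj ow; apply: grid_key_even; rewrite ow ou.
  by case/orP: uv => uv; [left|right] => w /kw kw' _; rewrite /ccw; lia.
have [ku kv] : (key u < k * l /\ key v < k * l)%N.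
  by split; apply: grid_key_even; rewrite -?ouv.
have kw w : adj u w -> (k * l <= key w)%N.
  by move=> /odd_grid_adj ow; apply: grid_key_odd; rewrite ow.
by case/orP: uv => uv; [left|right] => w /kw kw' _; rewrite /ccw; lia.
Qed.

(** The neighbours of u share the arc of v, so it suffices that they all precede or all follow v
    there; likewise for v and the arc of u. Cases [c1] to [c4] try these four possibilities. *)
Lemma extremal_opposite_classes u v : ~~ odd_v u -> odd_v v ->
  extremal u v \/ extremal v u.
Proof.
move=> ou ov.
have uw_odd w : adj u w -> odd_v w by move=> /odd_grid_adj ->.
have vw_even w : adj v w -> ~~ odd_v w by move=> /odd_grid_adj ->; rewrite negbK.
have ku := grid_key_even ou; have kv := grid_key_odd ov.
have kuw w : adj u w -> (k * l <= key w)%N by move=> /uw_odd/grid_key_odd.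
have kvw w : adj v w -> (key w < k * l)%N by move=> /vw_even/grid_key_even.
have keyo w : odd_v w -> (key w = k * l + (w.2 * k + w.1))%N.
  by rewrite /grid_key => ->.
have keye w : ~~ odd_v w -> (key w = w.1 * l + w.2)%N.
  by rewrite /grid_key => /negPf ->.
have neq w z : w != z ->
    ((w.1 : nat), (w.2 : nat)) != ((z.1 : nat), (z.2 : nat)).
  by case: w z => [w1 w2] [z1 z2]; rewrite !xpair_eqE.
have neq' w z : w != z ->
    ((w.2 : nat), (w.1 : nat)) != ((z.2 : nat), (z.1 : nat)).
  by move/neq; rewrite !xpair_eqE andbC.
(* The odd class is ordered by the second coordinate first, the even class by the first; the
   transposed form [near'] lets the same two lemmas serve both. *)
have near w z : adj w z -> grid_near w.1 w.2 z.1 z.2 by rewrite grid_adjE.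
have near' w z : adj w z -> grid_near w.2 w.1 z.2 z.1.
  by rewrite grid_adjE /grid_near orbC.
have [/andP[lt ex]|c1] := boolP ((u.2 < v.2) &&
    ~~ ((v.2 == u.2.+1 :> nat) && (v.1 < u.1)))%N.
  left; right=> w uw wv; have : (key w < key v)%N.
    rewrite !keyo ?ov ?uw_odd// ltn_add2l.
    exact: near_lex_lt (ltn_ord _) (near _ _ uw) (neq _ _ wv) lt ex.
  by move: (kuw _ uw); rewrite /ccw; lia.
have [/andP[gt ex]|c2] := boolP ((v.2 < u.2) &&
    ~~ ((u.2 == v.2.+1 :> nat) && (u.1 < v.1)))%N.
  left; left=> w uw wv; have : (key v < key w)%N.
    rewrite !keyo ?ov ?uw_odd// ltn_add2l.
    exact: near_lex_gt (ltn_ord _) (near _ _ uw) (neq _ _ wv) gt ex.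
  by move: (kuw _ uw); rewrite /ccw; lia.
have [/andP[lt ex]|c3] := boolP ((v.1 < u.1) &&
    ~~ ((u.1 == v.1.+1 :> nat) && (u.2 < v.2)))%N.
  right; right=> w vw wu; have : (key w < key u)%N.
    rewrite !keye ?ou ?vw_even//.
    exact: near_lex_lt (ltn_ord _) (near' _ _ vw) (neq' _ _ wu) lt ex.
  by move: (kvw _ vw); rewrite /ccw; lia.
have [/andP[gt ex]|c4] := boolP ((u.1 < v.1) &&
    ~~ ((v.1 == u.1.+1 :> nat) && (v.2 < u.2)))%N.
  right; left=> w vw wu; have : (key u < key w)%N.
    rewrite !keye ?ou ?vw_even//.
    exact: near_lex_gt (ltn_ord _) (near' _ _ vw) (neq' _ _ wu) gt ex.
  by move: (kvw _ vw); rewrite /ccw; lia.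
(* If all four fail, v is u, u + (1, -1) or u + (-1, 1). Each has the coordinate sum of u, against
   the opposite parities. *)
exfalso; clear -ou ov c1 c2 c3 c4.
move: ou ov c1 c2 c3 c4; case: u v => [[a ak] [b bl]] [[c ck] [d dl]] /=.
clear; lia.
Qed.

End GridKey.

Theorem theorem8 (R : realType) (k l : nat) (hk : (0 < k)%N) (hl : (0 < l)%N) :
  exists pos : 'I_k * 'I_l -> (R * R)%type,
    reducible_regular_oor (@grid_adj k l) pos.
Proof.
exists (circular_placement R (@grid_key k l)).
apply: circular_placement_reducible_oor.
- exact: grid_key_inj.
- exact: grid_adj_sym.
- exact: grid_adj_irrefl.
move=> u v uv; suff [uv'|vu] : extremal u v \/ extremal v u.
- by exists u, v; split=> //; left.
- by exists v, u; split=> //; right.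
have [ouv|] := eqVneq (odd (u.1 + u.2)) (odd (v.1 + v.2))%N.
  by left; exact: extremal_same_class.
have [ou|ou] := boolP (odd (u.1 + u.2)) => ov.
  by apply/or_comm/extremal_opposite_classes => //; case: odd ov.
by apply: extremal_opposite_classes => //; case: odd ov.
Qed.
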